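(* Let $\mathsf{e},\mathsf{f}$ be elements of the monoid $\mathbf{O}_N$ of rank $N$ Okada arc-diagrams. Then $\mathsf{e}\le_{\mathcal{J}}\mathsf{f}$ if and only if $\mathrm{PropLab}(\mathsf{e})\preceq\mathrm{PropLab}(\mathsf{f})$. In particular $\mathsf{e}$ and $\mathsf{f}$ belong to the same $\mathcal{J}$-class if and only if $\mathrm{PropLab}(\mathsf{e})=\mathrm{PropLab}(\mathsf{f})$.
   Context: Okada arc-diagrams. Let $[N]=\{1,\dots,N\}$, $\overline{[N]}=\{\bar1,\dots,\bar N\}$, $|i|=|\bar i|=i$, ordered by $1<\dots<N<\bar N<\dots<\bar1$. A non-crossing arc-diagram of rank $N$ is a perfect matching of $[N]\cup\overline{[N]}$ (pairs are arcs) with no arcs $\{a,b\},\{c,d\}$ with $a<c<b<d$. Arc $\{a<b\}$ is nested in $\{c<d\}$ if $c<a<b<d$. An arc is propagating if it joins an element of $[N]$ to an element of $\overline{[N]}$. An Okada arc-diagram is a non-crossing arc-diagram with integer labels on arcs such that the label of $\{a,b\}$ is at least $1$, at most $\min(|a|,|b|)$ and of the same parity as $\min(|a|,|b|)$, and an arc nested in another has a strictly larger label. Product: identify each node $\bar i$ of the left factor with node $i$ of the right factor, concatenate arcs, discard closed loops, and label each resulting arc by the minimum of the labels of the arcs composing it. This makes rank $N$ Okada arc-diagrams a monoid (identity: arcs $\{a,\bar a\}$ labelled $a$), isomorphic to and identified with the Okada monoid $\mathbf{O}_N$. $\mathrm{PropLab}(\mathsf{e})$ is the set of labels of the propagating arcs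 of $\mathsf{e}$; it is a Fibonacci set of rank $N$. A Fibonacci set of rank $N$ is a subset $S=\{s_1<\dots<s_k\}$ of $[N]$ with $k\equiv N\pmod2$ and $s_i\equiv i\pmod2$ for all $i$. Dominance order: for $S=\{s_1<\dots<s_k\}$ and $T=\{t_1<\dots<t_l\}$ Fibonacci sets of rank $N$, $S\preceq T$ if $k\le l$ and $s_{k-i}\le t_{l-i}$ for all $0\le i<k$. Green's $\mathcal{J}$-preorder on a monoid $M$: $x\le_{\mathcal{J}}y$ if $x=uyv$ for some $u,v\in M$; the $\mathcal{J}$-classes are the classes of the associated equivalence relation. *)

(* Defs.v *)
From HB Require Import structures.
From mathcomp Require Import all_boot.

Set Implicit Arguments.
Unset Strict Implicit.
Unset Printing Implicit Defensive.

(* [inl i] is the node i + 1 of [N]; [inr i] is the barred node of absolute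
   value i + 1. *)
Notation node N := ('I_N + 'I_N)%type.

Definition absn (N : nat) (x : node N) : nat :=
  match x with inl i => i.+1 | inr i => i.+1 end.

Definition barred (N : nat) (x : node N) : bool :=
  if x is inr _ then true else false.

(* Position (from 0) of a node in 1 < ... < N < bar N < ... < bar 1. *)
Definition pos (N : nat) (x : node N) : nat :=
  match x with inl i => i | inr i => N + (N - i.+1) end.

(* The arcs are the pairs {x, mate x}; [lab x] is the label of the arc
   through x.  Labels are at least 1, so natural numbers suffice. *)
Record diagram (N : nat) := Diagram {
  mate : {ffun node N -> node N};
  lab : {ffun node N -> nat} }.

Definition perfect_matching (N : nat) (d : diagram N) : bool :=
  [forall x, (mate d x != x) && (mate d (mate d x) == x)].

Definition noncrossing (N : nat) (d : diagram N) : bool :=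
  [forall a, forall c,
     ~~ [&& pos a < pos c, pos c < pos (mate d a)
          & pos (mate d a) < pos (mate d c)]].

(* The arc {a < mate a} is nested in the arc {c < mate c}. *)
Definition nested (N : nat) (d : diagram N) (a c : node N) : bool :=
  [&& pos c < pos a, pos a < pos (mate d a)
    & pos (mate d a) < pos (mate d c)].

Definition okada_labels (N : nat) (d : diagram N) : bool :=
  [&& [forall x, lab d (mate d x) == lab d x],
      [forall x, 1 <= lab d x <= minn (absn x) (absn (mate d x))],
      [forall x, odd (lab d x) == odd (minn (absn x) (absn (mate d x)))]
    & [forall a, forall c, nested d a c ==> (lab d c < lab d a)]].

Definition is_okada (N : nat) (d : diagram N) : bool :=
  [&& perfect_matching d, noncrossing d & okada_labels d].

Record okada (N : nat) := Okada {
  okada_diagram :> diagram N;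
  okadaP : is_okada okada_diagram }.
HB.instance Definition _ (N : nat) := [isSub for @okada_diagram N].

(* The graph obtained by putting d (nodes [inl _]) beside e (nodes [inr _]):
   its edges are the arcs of d, the arcs of e, and the identifications of the
   node bar i of d with the node i of e. *)
Definition glue (N : nat) (d e : diagram N) : rel (node N + node N) :=
  fun p q =>
    match p, q with
    | inl x, inl y => y == mate d x
    | inr x, inr y => y == mate e x
    | inl (inr i), inr (inl j) => i == j
    | inr (inl i), inl (inr j) => i == j
    | _, _ => false
    end.

(* A node of the product is a non-barred node of d or a barred node of e. *)
Definition outer (N : nat) (x : node N) : (node N + node N)%type :=
  if barred x then inr x else inl x.

Definition glue_lab (N : nat) (d e : diagram N) (p : node N + node N) : nat :=
  match p with inl x => lab d x | inr x => lab e x end.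

(* The component of [outer x] is a path whose other end is the mate of x in
   the product; closed loops are the components without outer node.  The
   default [x] is never used when d and e are matchings.  The initial value of
   the minimum is the label of the first arc of the path, which is itself one of
   the labels to be minimized. *)
Definition dmul (N : nat) (d e : diagram N) : diagram N :=
  Diagram
    [ffun x => odflt x
       [pick y | (y != x) && connect (glue d e) (outer x) (outer y)]]
    [ffun x => \big[minn/glue_lab d e (outer x)]_(p | connect (glue d e) (outer x) p)
       glue_lab d e p].

Definition leJ (N : nat) (e f : okada N) : Prop :=
  exists u v : okada N, okada_diagram e = dmul (dmul u f) v.

Definition eqJ (N : nat) (e f : okada N) : Prop := leJ e f /\ leJ f e.

(* All labels are at most N, so 'I_N.+1 contains all of them. *)
Definition PropLab (N : nat) (d : diagram N) : {set 'I_N.+1} :=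
  [set l : 'I_N.+1 | [exists x : node N,
     (barred x != barred (mate d x)) && (lab d x == l)]].

(* [elem S i] is the i-th smallest element of S, for 1 <= i <= #|S|; the
   enumeration of 'I_N.+1 is increasing. *)
Definition elem (N : nat) (S : {set 'I_N.+1}) (i : nat) : nat :=
  nth 0 [seq val s | s <- enum S] i.-1.

(* Only meant for Fibonacci sets, on which it is the dominance order. *)
Definition dominated (N : nat) (S T : {set 'I_N.+1}) : Prop :=
  #|S| <= #|T| /\
  forall i : nat, i < #|S| -> elem S (#|S| - i) <= elem T (#|T| - i).

(* Main.v *)
Require Import Defs.
From mathcomp Require Import all_boot order.
From mathcomp Require Import zify.

Set Implicit Arguments.
Unset Strict Implicit.
Unset Printing Implicit Defensive.

(** Cutting a diagram between [N] and its barred copy leaves two half-diagrams,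
    in which each propagating arc survives as an unmatched node, a defect, that
    keeps the label of the arc.  Propagating arcs are nested in one another, so
    the labels of the defects increase with their positions; a defect can be
    named by its label, the two halves have the same set of defect labels,
    PropLab, and gluing defects of equal label recovers the diagram
    ([join_left_half]).  The nodes on the left of a defect that are not defects
    are matched among themselves, so the k-th defect sits at a position of the
    parity of k ([odd_defect]).  It follows that halves of different diagrams
    with the same defect labels can be joined as well ([join_okada]).

    Suppose that the set S of labels of e is dominated by the set T of labels of
    f.  The difference of their sizes is even.  In a half of f, join the
    outermost superfluous defects in consecutive pairs, and relabel the other
    defects by S, which only lowers labels: this is [coarsen].  Multiply f on the
    left by the left half of e joined to the coarsened left half of f.  Each arc
    added by the coarsening connects two propagating arcs of f, whose right ends
    become matched in the same way, and every other propagating arc of f is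
    relabelled.  The product is therefore the left half of e joined to the
    coarsened right half of f ([join_product]).  A second multiplication, on the
    right, replaces that coarsened half by the right half of e
    ([dominated_leJ]).

    Conversely, let e = ufv.  The path that forms a propagating arc of a product
    traverses a propagating arc of each factor, whose label is at least that of
    the path ([cross_left], [cross_right]).  Different paths traverse different
    arcs, because a component of the gluing graph has at most two end points
    ([outer_uniq]).  Hence there is an injection of PropLab e into PropLab f that
    does not decrease labels ([leJ_inj]), and counting the labels above a
    threshold gives dominance ([dominated_inj]).  The statement on J-classes is
    the antisymmetry of dominance. *)

(** * Orbits of two involutions *)

Section TwoInvolutions.
Variables (T : finType) (a b : T -> T).
Hypotheses (aK : involutive a) (bK : involutive b).

Let turn p := b (a p).

Let turn_inj : injective turn.
Proof. exact: inj_comp (inv_inj bK) (inv_inj aK). Qed.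

(** The flip [b] reverses the rotation [turn], so it sends [turn^k x] to
    [turn^(-k) x] when it fixes [x]. *)
Lemma iter_turn_flip x k : b x = x -> iter k turn (b (iter k turn x)) = x.
Proof.
move=> bx; elim: k => //= k {2}<-.
by rewrite -iterS iterSr /turn bK aK.
Qed.

(** The orbit of the dihedral group generated by [a] and [b] through a fixed
    point of [b] is already the orbit of its rotation. *)
Lemma dihedral_orbit x p q :
  b x = x -> fconnect turn x p -> q = a p \/ q = b p -> fconnect turn x q.
Proof.
move=> bx /iter_findex; set k := findex _ _ _ => <-.
have back := iter_turn_flip k bx; move: (iter k turn x) back => r back.
rewrite (fconnect_sym turn_inj) => -[] ->; last first.
  by rewrite -[X in fconnect _ _ X]back fconnect_iter.
suff E : iter k.+1 turn (a r) = x by rewrite -[X in fconnect _ _ X]E fconnect_iter.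
by rewrite iterSr /turn aK.
Qed.

(** If [y = turn^k x] is also fixed by [b], then it equals [turn^(-k) x], so the
    length of the orbit divides [2k]: the second fixed point is antipodal to the
    first. *)
Lemma dihedral_fixed_index x y :
  b x = x -> b y = y -> y != x -> fconnect turn x y ->
  (findex turn x y).*2 = order turn x.
Proof.
move=> bx by_ neq xy; have kn := findex_max xy.
have yE := iter_findex xy; set k := findex _ _ _ in kn yE *.
have k0 : 0 < k by case: k yE {kn} => // E; rewrite -E eqxx in neq.
have kk : iter (k + k) turn x = x.
  by rewrite iterD; have := iter_turn_flip k bx; rewrite yE by_.
have [lt|le] := ltnP k.*2 (order turn x).
  have := @findex_iter _ turn x k.*2 lt; rewrite -addnn kk findex0; lia.
have E : iter (k.*2 - order turn x) turn x = x.
  have := iterD (k.*2 - order turn x) (order turn x) turn x.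
  by rewrite subnK // iter_order // -{1}addnn kk.
have := @findex_iter _ turn x (k.*2 - order turn x).
rewrite E findex0 => /(_ ltac:(lia)); lia.
Qed.

Lemma dihedral_fixed_uniq x y z :
  b x = x -> b y = y -> b z = z -> y != x -> z != x ->
  fconnect turn x y -> fconnect turn x z -> y = z.
Proof.
move=> bx by_ bz yx zx xy xz; rewrite -(iter_findex xy) -(iter_findex xz).
congr iter; apply: double_inj.
by rewrite !(dihedral_fixed_index bx).
Qed.
End TwoInvolutions.

(** * The mates of a product *)

Section Glue.
Variables (N : nat) (d e : diagram N).
Hypotheses (dK : involutive (mate d)) (eK : involutive (mate e)).

Definition arc_step (p : node N + node N) : node N + node N :=
  match p with inl x => inl (mate d x) | inr x => inr (mate e x) end.

Definition glue_step (p : node N + node N) : node N + node N :=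
  match p with
  | inl (inr i) => inr (inl i) | inr (inl i) => inl (inr i) | _ => p end.

Lemma arc_stepK : involutive arc_step.
Proof. by case=> x /=; rewrite ?dK ?eK. Qed.

Lemma glue_stepK : involutive glue_step.
Proof. by case=> [] []. Qed.

Lemma glue_step_outer x : glue_step (outer x) = outer x.
Proof. by case: x. Qed.

Lemma outer_inj : injective (@outer N).
Proof. by case=> i [] j //= []->. Qed.

Lemma glue_ll x y : glue d e (inl x) (inl y) = (y == mate d x).
Proof. by case: x. Qed.

Lemma glue_rr x y : glue d e (inr x) (inr y) = (y == mate e x).
Proof. by case: x. Qed.

Lemma glueP p q : glue d e p q -> q = arc_step p \/ q = glue_step p.
Proof.
by case: p q => [[i|i]|[i|i]] [[j|j]|[j|j]] //= /eqP E; rewrite ?E; auto.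
Qed.

Lemma glue_sym : symmetric (glue d e).
Proof.
have imp p q : glue d e p q -> glue d e q p.
  by case: p q => [[i|i]|[i|i]] [[j|j]|[j|j]] //= /eqP E; rewrite ?E ?dK ?eK.
by move=> p q; apply/idP/idP; apply: imp.
Qed.

Lemma connect_glue_sym : connect_sym (glue d e).
Proof. exact: sym_connect_sym glue_sym. Qed.

Lemma connect_glue_turn x p :
  connect (glue d e) (outer x) p ->
  fconnect (fun p => glue_step (arc_step p)) (outer x) p.
Proof.
case/connectP=> s; elim/last_ind: s p => [|s q IH] p /=.
  by move=> _ ->; apply: connect0.
rewrite rcons_path last_rcons => /andP[sP /glueP qE] ->.
exact: (dihedral_orbit arc_stepK glue_stepK (glue_step_outer x) (IH _ sP erefl)).
Qed.

(** A component of the gluing graph is an orbit of the two involutions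
    [arc_step] and [glue_step], and the outer nodes are fixed by the latter;
    so no component has three outer nodes. *)
Lemma outer_uniq x y z :
  y != x -> z != x -> connect (glue d e) (outer x) (outer y) ->
  connect (glue d e) (outer x) (outer z) -> y = z.
Proof.
move=> yx zx /connect_glue_turn xy /connect_glue_turn xz; apply: outer_inj.
by apply: (dihedral_fixed_uniq arc_stepK glue_stepK _ _ _ _ _ xy xz);
   rewrite ?glue_step_outer ?(inj_eq outer_inj).
Qed.

Lemma dmul_mate x y :
  y != x -> connect (glue d e) (outer x) (outer y) -> mate (dmul d e) x = y.
Proof.
move=> yx xy; rewrite ffunE; case: pickP => [z /andP[zx xz]|/(_ y)] /=.
  exact: outer_uniq zx yx xz xy.
by rewrite yx xy.
Qed.

Lemma dmul_mate_connect x : connect (glue d e) (outer x) (outer (mate (dmul d e) x)).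
Proof.
by rewrite ffunE; case: pickP => [z /andP[]|_] //=; apply: connect0.
Qed.

Lemma dmul_mateK : involutive (mate (dmul d e)).
Proof.
move=> x; have [Ex|neq] := eqVneq (mate (dmul d e) x) x; first by rewrite !Ex.
by apply: dmul_mate; rewrite 1?eq_sym // connect_glue_sym dmul_mate_connect.
Qed.

End Glue.

(** * The labels of a product *)

Lemma leq_bigminn (I : Type) (r : seq I) (P : pred I) (F : I -> nat) x0 L :
  (forall i, P i -> L <= F i) -> L <= x0 -> L <= \big[minn/x0]_(i <- r | P i) F i.
Proof. by move=> LF Lx; elim/big_rec: _ => // i y /LF; rewrite leq_min => ->. Qed.

Lemma bigminn_leq (I : finType) (P : pred I) (F : I -> nat) x0 i :
  P i -> \big[minn/x0]_(j | P j) F j <= F i.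
Proof.
move=> Pi; have : i \in index_enum I by rewrite mem_index_enum.
elim: (index_enum I) => // j r IH; rewrite inE big_cons.
case: eqP => [<- _|_ /= /IH le]; first by rewrite Pi geq_minl.
by case: ifP => // _; apply: leq_trans (geq_minr _ _) le.
Qed.

Section GlueLabels.
Variables (N : nat) (d e : diagram N).

Lemma dmul_lab_le x p :
  connect (glue d e) (outer x) p -> lab (dmul d e) x <= glue_lab d e p.
Proof. by move=> xp; rewrite ffunE; apply: bigminn_leq. Qed.

Lemma dmul_lab_ge x L :
  (forall p, connect (glue d e) (outer x) p -> L <= glue_lab d e p) ->
  L <= lab (dmul d e) x.
Proof. by move=> LF; rewrite ffunE; apply: leq_bigminn => //; apply: LF. Qed.

(** Computes the label of a product without enumerating the component: it is
    enough to guess a function that is constant along the edges of the gluing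
    graph, is bounded by the labels, and equals one of them in the component. *)
Lemma dmul_lab_invariant (F : node N + node N -> nat) x p :
  (forall p q, glue d e p q -> F q = F p) ->
  (forall p, F p <= glue_lab d e p) ->
  connect (glue d e) (outer x) p -> glue_lab d e p = F p ->
  lab (dmul d e) x = F (outer x).
Proof.
move=> Finv Fle xp Fp.
have Fc q : connect (glue d e) (outer x) q -> F q = F (outer x).
  case/connectP=> s; elim: s (outer x) => /= [y _ -> //|r s IH y].
  by case/andP=> /Finv <- /IH.
apply/eqP; rewrite eqn_leq -{1}(Fc _ xp) -Fp dmul_lab_le //=.
by apply: dmul_lab_ge => q xq; rewrite -(Fc _ xq).
Qed.

End GlueLabels.

(** * Half-diagrams *)

Lemma odd_card_involution (T : finType) (A : {set T}) (f : T -> T) :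
  {in A, forall x, [/\ f x \in A, f x != x & f (f x) = x]} -> ~~ odd #|A|.
Proof.
move: {2}#|A|.+1 (ltnSn #|A|) => n; elim: n A => // n IH A An fA.
have [->|[x xA]] := set_0Vmem A; first by rewrite cards0.
have [fxA fxx ffx] := fA x xA.
have fxA' : f x \in A :\ x by rewrite !inE fxx.
rewrite (cardsD1 x) xA (cardsD1 (f x)) fxA' /= negbK; apply: IH.
  by move: An; rewrite (cardsD1 x) xA (cardsD1 (f x)) fxA'; lia.
move=> y; rewrite !inE => /and3P[yfx yx yA].
have [fyA fyy ffy] := fA y yA; split=> //; rewrite fyA andbT.
apply/andP; split; first by apply: contra yx => /eqP E; rewrite -ffy E ffx.
by apply: contra yfx => /eqP E; rewrite -ffy E.
Qed.

(** Unmatched nodes are encoded as fixed points of [hmate]. *)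
Record half_diagram (N : nat) := Half {
  hmate : {ffun 'I_N -> 'I_N};
  hlab : {ffun 'I_N -> nat} }.

Definition defect N (h : half_diagram N) i := hmate h i == i.

(** [hmate_uncovered] and [hlab_defect] are the noncrossing and nesting
    conditions against an arc that leaves a defect to the right and passes over
    all later nodes. *)
Record half_shape (N : nat) (h : half_diagram N) : Prop := HalfShape {
  hmateK : involutive (hmate h);
  hmate_noncross : forall a c : 'I_N, a < c -> c < hmate h a -> hmate h a < hmate h c -> False;
  hmate_uncovered : forall a c : 'I_N, defect h c -> a < c -> c < hmate h a -> False;
  hlab_hmate : forall i, hlab h (hmate h i) = hlab h i;
  hlab_gt0 : forall i, 0 < hlab h i;
  hlab_le : forall i, hlab h i <= i.+1;
  hlab_nested : forall a c : 'I_N, c < a -> a < hmate h a ->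
    hmate h a < hmate h c -> hlab h c < hlab h a;
  hlab_defect : forall a c : 'I_N, defect h c -> c < a -> hlab h c < hlab h a }.

(** Kept apart from [half_shape] because the parity of the label of a defect in
    the half of a diagram is only known after [odd_defect], which rests on the
    shape: the label has the parity of the smaller end of the arc, which may lie
    in the other half. *)
Definition half_parity N (h : half_diagram N) :=
  forall i : 'I_N, i <= hmate h i -> odd (hlab h i) = ~~ odd i.

Definition has_labels N (h : half_diagram N) (s : seq nat) :=
  forall l, (l \in s) = [exists i, defect h i && (hlab h i == l)].

Section Half.
Variables (N : nat) (h : half_diagram N).
Hypothesis hS : half_shape h.

Lemma hlab_defect_inj i j : defect h i -> defect h j -> hlab h i = hlab h j -> i = j.
Proof.
move=> di dj E; apply: val_inj => /=; case: (ltngtP i j) => // lt.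
  by have := hlab_defect hS di lt; lia.
by have := hlab_defect hS dj lt; lia.
Qed.

Lemma has_labels_mem s i : has_labels h s -> defect h i -> hlab h i \in s.
Proof. by move=> sT di; rewrite sT; apply/existsP; exists i; rewrite di /=. Qed.

Lemma has_labels_defect s l : has_labels h s -> l \in s ->
  exists2 i, defect h i & hlab h i = l.
Proof. by move=> sT; rewrite sT => /existsP[i /andP[di /eqP]]; exists i. Qed.

(** If no arc passes over the cut before position [n], the nodes on its left that
    are not defects are matched in pairs, so [n] has the parity of the number of
    defects there.  [P] selects the labels of these defects. *)
Lemma odd_cut s n (P : pred nat) : has_labels h s -> uniq s -> n <= N ->
  (forall i : 'I_N, (hmate h i < n) = (i < n)) ->
  (forall i : 'I_N, defect h i -> P (hlab h i) = (i < n)) ->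
  odd n = odd (count P s).
Proof.
move=> sT su nN cut Pcut.
have : #|[set i : 'I_N | i < n]| = n.
  rewrite cardsE cardE -(size_map val) -[RHS](size_iota 0); apply: perm_size.
  apply: uniq_perm; rewrite ?iota_uniq ?map_inj_uniq ?enum_uniq //; first exact: val_inj.
  move=> k; rewrite mem_iota /=; apply/mapP/idP => [[i + ->]|kn].
    by rewrite mem_enum.
  by exists (Ordinal (leq_trans kn nN)) => //; rewrite mem_enum.
rewrite -(cardsID [set i | defect h i]) => <-; rewrite oddD.
rewrite (negbTE (_ : ~~ odd #|_ :\: _|)) ?addbF; last first.
  apply: (@odd_card_involution _ _ (hmate h)) => i; rewrite !inE => /andP[di lt].
  by rewrite (hmateK hS) /defect (hmateK hS) cut eq_sym di lt.
congr (odd _); rewrite -size_filter cardE -(size_map (hlab h)); apply: perm_size.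
apply: uniq_perm; rewrite ?filter_uniq ?map_inj_in_uniq ?enum_uniq //.
  move=> i j; rewrite !mem_enum !inE => /andP[_ di] /andP[_ dj].
  exact: hlab_defect_inj.
move=> l; rewrite mem_filter; apply/mapP/andP => [[i + ->]|[Pl]].
  rewrite mem_enum !inE => /andP[lt di].
  by rewrite Pcut // has_labels_mem.
move/(has_labels_defect sT) => [i di E]; exists i => //.
by rewrite mem_enum !inE di -Pcut // E Pl.
Qed.

(** The cut after the last node. *)
Lemma odd_size_labels s : has_labels h s -> uniq s -> odd (size s) = odd N.
Proof.
move=> sT su; rewrite -(count_predT s) -(@odd_cut s N predT) // => i.
  by rewrite !ltn_ord.
by rewrite ltn_ord.
Qed.

(** The cut just before a defect: the parity of its position is determined by the
    rank of its label, hence is the same in all halves with the same labels. *)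
Lemma odd_defect s i : has_labels h s -> uniq s -> defect h i ->
  odd i = odd (count (ltn^~ (hlab h i)) s).
Proof.
move=> sT su di; apply: odd_cut => //; first exact: ltnW.
  have no (a : 'I_N) : a < i -> hmate h a < i.
    move=> lt; apply/idP; rewrite ltnNge leq_eqVlt; apply/negP => /orP[/eqP/val_inj E|].
      by move: lt; rewrite -(hmateK hS a) -E (eqP di) ltnn.
    exact: (hmate_uncovered hS di lt).
  move=> a; apply/idP/idP => lt; last exact: no.
  by rewrite -(hmateK hS a); apply: no.
move=> j dj /=; apply/idP/idP => [|lt]; last exact: (hlab_defect hS).
apply: contraTT; rewrite -!leqNgt leq_eqVlt => /orP[/eqP/val_inj->//|lt].
by have := hlab_defect hS di lt; lia.
Qed.
End Half.

Record okada_half N (t : seq nat) (h : half_diagram N) : Prop := OkadaHalf {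
  half_is_shape :> half_shape h;
  half_has_parity : half_parity h;
  half_has_labels : has_labels h t }.

(** * Diagrams and their halves *)

(** With [lab_mate], bounding the label by the absolute value of an arbitrary end
    and prescribing its parity at the smaller end is equivalent to the conditions
    in terms of the minimum of the two. *)
Record okada_spec N (d : diagram N) : Prop := OkadaSpec {
  mateK : involutive (mate d);
  mate_neq : forall x, mate d x != x;
  mate_noncross : forall a c, pos a < pos c -> pos c < pos (mate d a) ->
    pos (mate d a) < pos (mate d c) -> False;
  lab_mate : forall x, lab d (mate d x) = lab d x;
  lab_gt0 : forall x, 0 < lab d x;
  lab_le : forall x, lab d x <= absn x;
  lab_odd : forall x, absn x <= absn (mate d x) -> odd (lab d x) = odd (absn x);
  lab_nested : forall a c, pos c < pos a -> pos a < pos (mate d a) ->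
    pos (mate d a) < pos (mate d c) -> lab d c < lab d a }.

Lemma is_okadaP N (d : diagram N) : reflect (okada_spec d) (is_okada d).
Proof.
apply: (iffP and3P) => [[/forallP mP /forallP ncP /and4P[]]|[mK mN nc lm l0 ll lo ln]].
  move=> /forallP lmP /forallP lbP /forallP loP /forallP lnP.
  have mK : involutive (mate d) by move=> x; have /andP[_ /eqP] := mP x.
  split=> // [x|a c ac cma mac|x|x|x|x le|a c ca ama mac].
  - by have /andP[] := mP x.
  - by have /forallP/(_ c)/negP[] := ncP a; apply/and3P.
  - exact/eqP.
  - by have /andP[] := lbP x.
  - by have /andP[_] := lbP x; rewrite leq_min => /andP[].
  - by have /eqP := loP x; rewrite (minn_idPl le).
  - have /forallP/(_ c)/implyP := lnP a; apply; exact/and3P.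
split; first by apply/forallP=> x; rewrite mN mK eqxx.
  by apply/forallP=> a; apply/forallP=> c; apply/negP=> /and3P[]; apply: nc.
apply/and4P; split; apply/forallP => x.
- exact/eqP.
- by rewrite l0 leq_min ll -lm ll.
- apply/eqP; case: (leqP (absn x) (absn (mate d x))) => [|/ltnW] le.
    exact: lo.
  by rewrite -lm lo // mK.
- by apply/forallP=> c; apply/implyP=> /and3P[]; apply: ln.
Qed.

Definition flipn N (x : node N) : node N :=
  match x with inl i => inr i | inr i => inl i end.

Lemma flipnK N : involutive (@flipn N). Proof. by case. Qed.

Lemma pos_flipn_lt N (x y : node N) : (pos (flipn x) < pos (flipn y)) = (pos y < pos x).
Proof. by case: x y => i [] j /=; have := ltn_ord i; have := ltn_ord j; lia. Qed.

Lemma absn_flipn N (x : node N) : absn (flipn x) = absn x.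
Proof. by case: x. Qed.

(** The reflection that exchanges [N] and its barred copy reverses the order of
    all nodes; it makes right halves instances of left halves. *)
Definition flip N (d : diagram N) : diagram N :=
  Diagram [ffun x => flipn (mate d (flipn x))] [ffun x => lab d (flipn x)].

Lemma flip_okada N (d : diagram N) : okada_spec d -> okada_spec (flip d).
Proof.
case=> mK mN nc lm l0 ll lo ln.
split=> [x|x|a c|x|x|x|x|a c]; rewrite !ffunE //.
- by rewrite flipnK mK flipnK.
- by rewrite (can2_eq (@flipnK N) (@flipnK N)).
- rewrite -[a]flipnK -[c]flipnK !pos_flipn_lt !(flipnK (flipn _)) => ac cma mac.
  by apply: (nc (mate d (flipn c)) (mate d (flipn a))); rewrite ?mK ?pos_flipn_lt.
- by rewrite flipnK.
- by rewrite -absn_flipn.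
- by rewrite absn_flipn -(absn_flipn x) => /lo.
- rewrite -[a]flipnK -[c]flipnK !pos_flipn_lt !(flipnK (flipn _)) => ca ama mac.
  by rewrite -(lm (flipn a)) -(lm (flipn c)); apply: ln; rewrite ?mK ?pos_flipn_lt.
Qed.

Definition left_half N (d : diagram N) : half_diagram N :=
  Half [ffun i => if mate d (inl i) is inl j then j else i] [ffun i => lab d (inl i)].

Section LeftHalf.
Variables (N : nat) (d : diagram N).
Hypothesis dS : okada_spec d.

Lemma left_half_defect i : defect (left_half d) i = barred (mate d (inl i)).
Proof.
rewrite /defect ffunE; case E : (mate d (inl i)) => [j|j] /=; last exact: eqxx.
by apply/negP => /eqP ji; have := mate_neq dS (inl i); rewrite E ji eqxx.
Qed.

Lemma left_half_shape : half_shape (left_half d).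
Proof.
case: (dS) => mK mN nc lm l0 ll lo ln.
split=> [i|a c|a c|i|i|i|a c|a c]; rewrite ?left_half_defect ?ffunE //.
- case E : (mate d (inl i)) => [j|j]; last by rewrite E.
  by rewrite -E mK.
- move=> ac; have := nc (inl a) (inl c) ac.
  by case: (mate d (inl a)) (mate d (inl c)) => [a'|a'] [c'|c'] //=; lia.
- case: (mate d (inl c)) (nc (inl a) (inl c)) => //= c' nc' _ ac.
  case: (mate d (inl a)) nc' => [a'|a'] //=; last lia.
  by move=> nc' ca; apply: nc' => //; have := ltn_ord a'; lia.
- by case E : (mate d (inl i)) => [j|//]; rewrite -E lm.
- move=> ca; have := ln (inl a) (inl c) ca.
  by case: (mate d (inl a)) (mate d (inl c)) => [a'|a'] [c'|c'] //=;
     have := ltn_ord a'; lia.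
- case E : (mate d (inl c)) => [|c'] //= _ ca.
  have nested (b : 'I_N) : c < b -> pos (inl b) < pos (mate d (inl b)) ->
      lab d (inl c) < lab d (inl b).
    move=> cb bmb; apply: ln => //; have := nc (inl c) (inl b) cb.
    rewrite E /= in bmb *; have := mK (inl b); case: (mate d (inl b)) bmb => [b'|b'] /=.
      by have := ltn_ord b'; lia.
    move=> _ Eb nc'; have : b' != c' :> nat.
      apply/eqP => /val_inj bc'; have := mK (inl c); rewrite E -bc' Eb => -[bc].
      by move: cb; rewrite bc ltnn.
    by have := ltn_ord b; have := ltn_ord c'; have := ltn_ord b'; lia.
  have [lt|ge] := ltnP (pos (inl a)) (pos (mate d (inl a))); first exact: nested.
  rewrite -(lm (inl a)); case Ea : (mate d (inl a)) ge => [a'|a'] /= ge; last first.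
    by have := ltn_ord a; lia.
  have Ea' : mate d (inl a') = inl a by rewrite -Ea mK.
  have ne : a' <> a by move=> aa; have := mN (inl a); rewrite Ea aa eqxx.
  have lt : a' < a by rewrite ltn_neqAle ge andbT; apply/eqP => /val_inj.
  apply: nested; last by rewrite Ea'.
  case: (ltngtP a' c) => // [lt'|/val_inj E']; last first.
    by move: E; rewrite -E' Ea'.
  by have := nc (inl a') (inl c); rewrite Ea' E /=; have := ltn_ord a; lia.
Qed.
End LeftHalf.

Definition labs N (S : {set 'I_N.+1}) : seq nat := [seq val s | s <- enum S].

Lemma labs_sorted N (S : {set 'I_N.+1}) : sorted ltn (labs S).
Proof.
suff -> : labs S = [seq x <- iota 0 N.+1 | x \in labs S].
  by apply: sorted_filter (iota_ltn_sorted _ _); apply: ltn_trans.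
rewrite -[iota 0 N.+1]val_enum_ord filter_map enumT; congr map.
rewrite [LHS]/enum_mem; apply: eq_filter => s /=.
by rewrite (mem_map val_inj) mem_enum.
Qed.

Lemma labs_uniq N (S : {set 'I_N.+1}) : uniq (labs S).
Proof. by rewrite map_inj_uniq ?enum_uniq //; apply: val_inj. Qed.

Lemma size_labs N (S : {set 'I_N.+1}) : size (labs S) = #|S|.
Proof. by rewrite size_map cardE. Qed.

Lemma labs_inj N : injective (@labs N).
Proof.
move=> S T E; apply/setP => s; rewrite -(mem_enum S) -(mem_enum T).
by rewrite -!(mem_map val_inj) -/(labs S) E.
Qed.

Lemma elemE N (S : {set 'I_N.+1}) i : elem S i = nth 0 (labs S) i.-1.
Proof. by []. Qed.

Lemma PropLab_flip N (d : diagram N) : PropLab (flip d) = PropLab d.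
Proof.
apply/setP=> l; rewrite !inE; apply/existsP/existsP => -[x];
  rewrite ?ffunE => /andP[xP lP]; exists (flipn x); rewrite ?ffunE ?flipnK ?lP ?andbT //.
  by move: xP; case: (x) => i /=; case: (mate d _).
by move: xP; case: (x) => i /=; case: (mate d _).
Qed.

Section LeftHalfLabels.
Variables (N : nat) (d : diagram N).
Hypothesis dS : okada_spec d.

Lemma left_half_labels : has_labels (left_half d) (labs (PropLab d)).
Proof.
move=> l; apply/mapP/existsP => [[s + ->]|[i /andP[di /eqP li]]]; last first.
  have lN : l < N.+1.
    by rewrite -li ffunE ltnS (leq_trans (lab_le dS _)) //=; apply: ltn_ord.
  exists (Ordinal lN) => //; rewrite mem_enum inE; apply/existsP; exists (inl i).
  by move: di li; rewrite left_half_defect // ffunE /= => -> /eqP ->.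
rewrite mem_enum inE => /existsP[[i|i]] /andP[bP sl].
  exists i; rewrite left_half_defect // ffunE sl andbT.
  by move: bP; case: (mate d (inl i)).
case E: (mate d (inr i)) bP => [j|//] _; exists j.
by rewrite left_half_defect // ffunE -E (mateK dS) /= (lab_mate dS) sl.
Qed.
End LeftHalfLabels.

(** The two ends of a propagating arc are defects with the same label in the two
    halves, so their positions have the same parity and it does not matter which
    one is smaller. *)
Lemma left_half_parity N (d : diagram N) : okada_spec d -> half_parity (left_half d).
Proof.
move=> dS i; have fS := flip_okada dS.
have iP := odd_defect (left_half_shape dS) (left_half_labels dS) (labs_uniq _).
have jP := odd_defect (left_half_shape fS) (left_half_labels fS) (labs_uniq _).
rewrite !ffunE; case E : (mate d (inl i)) => [j|j] le.
  by rewrite (lab_odd dS) // E /= ltnS.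
have {}iP : odd i = odd j.
  rewrite iP ?jP ?left_half_defect ?ffunE ?E //=; last by rewrite -E (mateK dS).
  by rewrite -E (lab_mate dS) PropLab_flip.
have [le'|lt] := leqP i j; first by rewrite (lab_odd dS) // E /= ltnS.
rewrite -(lab_mate dS) iP (lab_odd dS) ?E //= -E (mateK dS) /=; exact: ltnW.
Qed.

Lemma left_half_okada N (d : diagram N) : okada_spec d ->
  okada_half (labs (PropLab d)) (left_half d).
Proof.
by move=> dS; split;
   [apply: left_half_shape|apply: left_half_parity|apply: left_half_labels].
Qed.

Definition defect_of_label N (k : half_diagram N) (i0 : 'I_N) (s : nat) : 'I_N :=
  odflt i0 [pick j | defect k j && (hlab k j == s)].

Section DefectOfLabel.
Variables (N : nat) (k : half_diagram N) (i0 : 'I_N) (t : seq nat).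
Hypotheses (kS : half_shape k) (kT : has_labels k t).

Lemma defect_of_labelE j : defect k j -> defect_of_label k i0 (hlab k j) = j.
Proof.
move=> dj; rewrite /defect_of_label; case: pickP => [i /andP[di /eqP E]|/(_ j)] /=.
  exact: hlab_defect_inj E.
by rewrite dj eqxx.
Qed.

Lemma defect_of_labelP s : s \in t -> defect k (defect_of_label k i0 s).
Proof. by case/(has_labels_defect kT) => j dj <-; rewrite defect_of_labelE. Qed.

Lemma hlab_defect_of_label s : s \in t -> hlab k (defect_of_label k i0 s) = s.
Proof. by case/(has_labels_defect kT) => j dj <-; rewrite defect_of_labelE. Qed.
End DefectOfLabel.

(** The right half is reflected: [k] describes the barred nodes, numbered by
    absolute value. *)
Definition join N (h k : half_diagram N) : diagram N :=
  Diagram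
    [ffun x => match x with
       | inl i => if defect h i then inr (defect_of_label k i (hlab h i)) else inl (hmate h i)
       | inr j => if defect k j then inl (defect_of_label h j (hlab k j)) else inr (hmate k j)
       end]
    [ffun x => match x with inl i => hlab h i | inr j => hlab k j end].

Lemma diagram_eq N (d e : diagram N) : mate d =1 mate e -> lab d =1 lab e -> d = e.
Proof. by case: d e => md ld [me le] /= /ffunP -> /ffunP ->. Qed.

Lemma join_left_half N (d : diagram N) : okada_spec d ->
  join (left_half d) (left_half (flip d)) = d.
Proof.
move=> dS; have fS := flip_okada dS.
apply: diagram_eq => -[i|j]; rewrite !ffunE //= left_half_defect //.
  case E: (mate d (inl i)) => [j|j] //=; rewrite ?E //.
  have -> : lab d (inl i) = hlab (left_half (flip d)) j.
    by rewrite !ffunE /= -E (lab_mate dS).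
  rewrite (defect_of_labelE _ (left_half_shape fS)) // left_half_defect //.
  by rewrite ffunE /= -E (mateK dS).
rewrite ffunE /=; case E: (mate d (inr j)) => [i|i] //=; rewrite ?E //.
have -> : lab d (inr j) = hlab (left_half d) i by rewrite !ffunE /= -E (lab_mate dS).
by rewrite (defect_of_labelE _ (left_half_shape dS)) // left_half_defect // -E (mateK dS).
Qed.

Lemma defect_lt N (g : half_diagram N) (i j : 'I_N) :
  half_shape g -> defect g i -> defect g j ->
  (hlab g i < hlab g j) = (i < j).
Proof.
move=> gS di dj; apply/idP/idP => lt; last exact: (hlab_defect gS).
case: (ltngtP i j) => // [ji|/val_inj ij]; last by rewrite ij ltnn in lt.
by have := hlab_defect gS dj ji; lia.
Qed.

Section Join.
Variables (N : nat) (h k : half_diagram N) (t : seq nat).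
Hypotheses (hO : okada_half t h) (kO : okada_half t k).
Let hS : half_shape h := hO.
Let kS : half_shape k := kO.
Let hP := half_has_parity hO.
Let kP := half_has_parity kO.
Let hT := half_has_labels hO.
Let kT := half_has_labels kO.

Variant join_mate_spec (x : node N) : node N -> Type :=
  | JoinLL i of x = inl i & hmate h i <> i : join_mate_spec x (inl (hmate h i))
  | JoinRR j of x = inr j & hmate k j <> j : join_mate_spec x (inr (hmate k j))
  | JoinLR i j of x = inl i & defect h i & defect k j & hlab h i = hlab k j : 
    join_mate_spec x (inr j)
  | JoinRL i j of x = inr j & defect h i & defect k j & hlab h i = hlab k j : 
    join_mate_spec x (inl i).

Lemma join_mateP x : join_mate_spec x (mate (join h k) x).
Proof.
rewrite ffunE; case: x => [i|j]; case: ifP => dx.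
- have ti := has_labels_mem hT dx.
  apply: JoinLR (erefl _) dx (defect_of_labelP _ kS kT ti) _.
  by rewrite (hlab_defect_of_label _ kS kT).
- by apply: JoinLL => //; apply/eqP/negbT.
- have tj := has_labels_mem kT dx.
  apply: JoinRL (erefl _) (defect_of_labelP _ hS hT tj) dx _.
  by rewrite (hlab_defect_of_label _ hS hT).
- by apply: JoinRR => //; apply/eqP/negbT.
Qed.

Lemma join_mateK : involutive (mate (join h k)).
Proof.
move=> x; case: (join_mateP x) => [i ->|j ->|i j -> di dj E|i j -> di dj E];
  rewrite ffunE /=.
- by move/eqP; rewrite /defect (hmateK hS) eq_sym => /negbTE->.
- by move/eqP; rewrite /defect (hmateK kS) eq_sym => /negbTE->.
- by rewrite dj -E (defect_of_labelE _ hS di).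
- by rewrite di E (defect_of_labelE _ kS dj).
Qed.


(** For two propagating arcs, the order of the unbarred ends is that of the
    labels, hence that of the barred ends.  A propagating arc does not cross an
    arc of one half because defects are uncovered. *)
Lemma join_noncross a c : pos a < pos c -> pos c < pos (mate (join h k) a) ->
  pos (mate (join h k) a) < pos (mate (join h k) c) -> False.
Proof.
case: (join_mateP a) => [i -> ni|j -> nj|i j -> di dj ij|i j -> di dj ij];
case: (join_mateP c) => [i' -> ni'|j' -> nj'|i' j' -> di' dj' ij'|i' j' -> di' dj' ij'] /=.
- exact: (hmate_noncross hS).
- by have := ltn_ord (hmate h i); lia.
- by move=> lt lt' _; apply: (hmate_uncovered hS di' lt lt').
- by have := ltn_ord (hmate h i); lia.
- by have := ltn_ord i'; lia.
- move=> lt lt' lt''.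
  apply: (hmate_noncross kS (a := hmate k j') (c := hmate k j)); rewrite ?(hmateK kS);
  have := ltn_ord j; have := ltn_ord j'; have := ltn_ord (hmate k j); lia.
- by have := ltn_ord i'; lia.
- by have := ltn_ord i'; lia.
- by have := ltn_ord (hmate h i'); have := ltn_ord i; lia.
- move=> lt lt' lt''; apply: (hmate_uncovered kS dj (a := hmate k j')); rewrite ?(hmateK kS);
  have := ltn_ord j; have := ltn_ord j'; have := ltn_ord (hmate k j'); lia.
- rewrite -(defect_lt hS di di') ij ij' (defect_lt kS dj dj').
  by have := ltn_ord j; have := ltn_ord j'; lia.
- by have := ltn_ord i'; have := ltn_ord j; lia.
- by have := ltn_ord i'; lia.
- by have := ltn_ord i; lia.
- by have := ltn_ord i'; lia.
- by have := ltn_ord i; lia.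
Qed.

Lemma join_nested a c : pos c < pos a -> pos a < pos (mate (join h k) a) ->
  pos (mate (join h k) a) < pos (mate (join h k) c) ->
  lab (join h k) c < lab (join h k) a.
Proof.
case: (join_mateP a) => [i -> ni|j -> nj|i j -> di dj ij|i j -> di dj ij];
case: (join_mateP c) => [i' -> ni'|j' -> nj'|i' j' -> di' dj' ij'|i' j' -> di' dj' ij'] /=;
rewrite !ffunE.
- exact: (hlab_nested hS).
- by have := ltn_ord i; lia.
- by move=> lt _ _; apply: (hlab_defect hS di' lt).
- by have := ltn_ord i; lia.
- by have := ltn_ord (hmate h i'); lia.
- move=> lt lt' lt''; rewrite -(hlab_hmate kS j) -(hlab_hmate kS j').
  apply: (hlab_nested kS); rewrite ?(hmateK kS);
  have := ltn_ord j; have := ltn_ord j'; have := ltn_ord (hmate k j); lia.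
- move=> lt lt' lt''; rewrite ij' -(hlab_hmate kS j); apply: (hlab_defect kS dj').
  have := ltn_ord j; have := ltn_ord j'; have := ltn_ord (hmate k j); lia.
- by have := ltn_ord i'; lia.
- by have := ltn_ord (hmate h i'); have := ltn_ord i; lia.
- by have := ltn_ord j'; have := ltn_ord i; lia.
- by move=> lt _ _; apply: (hlab_defect hS di' lt).
- by have := ltn_ord j'; have := ltn_ord i; lia.
- by have := ltn_ord i; lia.
- by have := ltn_ord i; lia.
- by have := ltn_ord i; lia.
- by have := ltn_ord i; lia.
Qed.

Lemma join_okada : okada_spec (join h k).
Proof.
split; try move=> x.
- exact: join_mateK.
- case: (join_mateP x) => [i -> ni|j -> nj|i j ->|i j ->] //.
    by apply/eqP => -[].
  by apply/eqP => -[].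
- exact: join_noncross.
- case: (join_mateP x) => [i -> _|j -> _|i j -> _ _ E|i j -> _ _ E]; rewrite !ffunE //.
  + exact: hlab_hmate.
  + exact: hlab_hmate.
- by rewrite ffunE; case: x => i; rewrite hlab_gt0.
- by rewrite ffunE; case: x => i; rewrite hlab_le.
- case: (join_mateP x) => [i -> _|j -> _|i j -> di dj E|i j -> di dj E];
    rewrite !ffunE /= ltnS.
  + exact: hP.
  + exact: kP.
  + by rewrite hP // (eqP di).
  + by rewrite kP // (eqP dj).
- exact: join_nested.
Qed.
End Join.

(** * Coarsening a half-diagram *)

Record fibonacci (s : seq nat) : Prop := Fibonacci {
  fib_sorted : sorted ltn s;
  fib_gt0 : forall l, l \in s -> 0 < l;
  fib_odd : forall k, k < size s -> odd (nth 0 s k) = ~~ odd k }.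

Lemma sorted_nth_lt s j k : sorted ltn s -> j < size s -> k < size s ->
  (nth 0 s j < nth 0 s k) = (j < k).
Proof. by move=> sS js ks; apply: (Order.POrderTheory.lt_sorted_ltn_nth 0 sS). Qed.

Lemma sorted_uniq_ltn s : sorted ltn s -> uniq s.
Proof. exact: (@sorted_uniq _ ltn ltn_trans ltnn). Qed.

Lemma half_fibonacci N (h : half_diagram N) s : okada_half s h -> sorted ltn s -> fibonacci s.
Proof.
case=> hS hP hT sS; split=> // [l|k ks].
  by case/(has_labels_defect hT) => i _ <-; apply: hlab_gt0.
have [i di li] := has_labels_defect hT (mem_nth 0 ks).
rewrite -{1}li hP ?(eqP di) // (odd_defect hS hT (sorted_uniq_ltn sS) di) li.
by rewrite (Order.POrderTheory.count_lt_nth 0 sS ks).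
Qed.

(** Pairs the ranks 0 and 1, 2 and 3, and so on. *)
Definition partner k := if odd k then k.-1 else k.+1.

Lemma partnerK : involutive partner.
Proof. by move=> k; rewrite /partner; case: (boolP (odd k)) => kP; case: ifP; lia. Qed.

(** Dominance of the sets enumerated by [s] and [t], with the two sequences
    aligned at their largest elements. *)
Record fib_le (s t : seq nat) : Prop := FibLe {
  fib_le_l : fibonacci s;
  fib_le_r : fibonacci t;
  fib_le_size : size s <= size t;
  fib_le_parity : odd (size s) = odd (size t);
  fib_le_nth : forall k, k < size s -> nth 0 s k <= nth 0 t (k + (size t - size s)) }.

Section Coarsen.
Variables (s t : seq nat).
Hypothesis st : fib_le s t.
Let sF := fib_le_l st.
Let tF := fib_le_r st.
Let dom_st := fib_le_nth st.

Let delta := size t - size s.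

(** The new label depends on the old one only, so that both ends of a propagating
    arc receive the same label when the two halves of a diagram are coarsened.
    The minimum is the label of the outer of the two propagating arcs whose ends
    are joined. *)
Definition coarse_lab l :=
  let k := index l t in
  if k < size t - size s then minn l (nth 0 t (partner k))
  else nth 0 s (k - (size t - size s)).

Definition coarsen N (h : half_diagram N) : half_diagram N :=
  Half
    [ffun i => let k := index (hlab h i) t in
       if defect h i && (k < size t - size s) then defect_of_label h i (nth 0 t (partner k))
       else hmate h i]
    [ffun i => if defect h i then coarse_lab (hlab h i) else hlab h i].

Lemma index_nth_fibonacci k : k < size t -> index (nth 0 t k) t = k.
Proof. by move=> kt; rewrite index_uniq // (sorted_uniq_ltn (fib_sorted tF)). Qed.

Lemma shift_lt k : k < size s -> k + delta < size t.
Proof. by have := fib_le_size st; rewrite /delta; lia. Qed.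

Lemma closed_lt k : k < delta -> k < size t.
Proof. by rewrite /delta; lia. Qed.

Lemma odd_delta : odd delta = false.
Proof. by rewrite /delta oddB ?fib_le_size // (fib_le_parity st) addbb. Qed.

Lemma partner_lt k : k < delta -> partner k < delta.
Proof. by rewrite /partner; have := odd_delta; case: ifP; lia. Qed.

Lemma nth_partner_neq k : k < delta -> nth 0 t k <> nth 0 t (partner k).
Proof.
move=> kd E; have := index_nth_fibonacci (closed_lt kd).
rewrite E (index_nth_fibonacci (closed_lt (partner_lt kd))) /partner.
by case: ifP; lia.
Qed.

Lemma coarse_lab_kept k : k < size s -> coarse_lab (nth 0 t (k + delta)) = nth 0 s k.
Proof.
move=> ks; rewrite /coarse_lab (index_nth_fibonacci (shift_lt ks)) -/delta addnK.
by rewrite ltnNge leq_addl.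
Qed.

Lemma coarse_lab_closed k : k < delta ->
  coarse_lab (nth 0 t k) = minn (nth 0 t k) (nth 0 t (partner k)).
Proof. by move=> kd; rewrite /coarse_lab (index_nth_fibonacci (closed_lt kd)) kd. Qed.

Lemma coarse_lab_le l : l \in t -> coarse_lab l <= l.
Proof.
move=> lt; rewrite /coarse_lab; case: ifP => [_|kd]; first exact: geq_minl.
have kt : index l t < size t by rewrite index_mem.
have ks : index l t - delta < size s.
  by have := fib_le_size st; rewrite /delta in kd *; lia.
by have := dom_st ks; rewrite subnK ?nth_index // leqNgt kd.
Qed.

Section CoarsenHalf.
Variables (N : nat) (h : half_diagram N).
Hypothesis hO : okada_half t h.
Let hS : half_shape h := hO.
Let hP := half_has_parity hO.
Let hT := half_has_labels hO.

Lemma rank_lt (i j : 'I_N) k l : defect h i -> defect h j -> k < size t -> l < size t ->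
  hlab h i = nth 0 t k -> hlab h j = nth 0 t l -> (i < j) = (k < l).
Proof.
move=> di dj kt lt ik jl.
by rewrite -(defect_lt hS di dj) ik jl sorted_nth_lt // (fib_sorted tF).
Qed.

Lemma rank_exists k : k < size t -> exists2 i, defect h i & hlab h i = nth 0 t k.
Proof. by move=> kt; apply: has_labels_defect hT _; apply: mem_nth. Qed.

Lemma coarsen_arc i : ~~ defect h i ->
  hmate (coarsen h) i = hmate h i /\ hlab (coarsen h) i = hlab h i.
Proof. by move=> ni; rewrite !ffunE /= (negbTE ni). Qed.

Lemma coarsen_kept i k : k < size s -> defect h i -> hlab h i = nth 0 t (k + delta) ->
  hmate (coarsen h) i = i /\ hlab (coarsen h) i = nth 0 s k.
Proof.
move=> ks di li; rewrite !ffunE /= di li coarse_lab_kept //; split=> //.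
rewrite (index_nth_fibonacci (shift_lt ks)) -/delta ltnNge leq_addl /=.
exact: eqP di.
Qed.

Lemma coarsen_closed i j k : k < delta -> defect h i -> defect h j ->
  hlab h i = nth 0 t k -> hlab h j = nth 0 t (partner k) ->
  hmate (coarsen h) i = j /\ hlab (coarsen h) i = minn (nth 0 t k) (nth 0 t (partner k)).
Proof.
move=> kd di dj li lj; rewrite !ffunE /= di li coarse_lab_closed //; split=> //.
by rewrite (index_nth_fibonacci (closed_lt kd)) kd -lj defect_of_labelE.
Qed.

Variant coarsen_spec (i : 'I_N) : 'I_N -> nat -> Type :=
  | CoarsenArc of ~~ defect h i : coarsen_spec i (hmate h i) (hlab h i)
  | CoarsenClosed j k of k < delta & partner k < delta & defect h i & defect h j &
      hlab h i = nth 0 t k & hlab h j = nth 0 t (partner k) :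
      coarsen_spec i j (minn (nth 0 t k) (nth 0 t (partner k)))
  | CoarsenKept k of k < size s & defect h i & hlab h i = nth 0 t (k + delta) :
      coarsen_spec i i (nth 0 s k).

Lemma coarsenP i : coarsen_spec i (hmate (coarsen h) i) (hlab (coarsen h) i).
Proof.
case: (boolP (defect h i)) => di; last first.
  by have [-> ->] := coarsen_arc di; apply: CoarsenArc.
have tl := has_labels_mem hT di.
have kt : index (hlab h i) t < size t by rewrite index_mem.
have lE : hlab h i = nth 0 t (index (hlab h i) t) by rewrite nth_index.
case: (ltnP (index (hlab h i) t) delta) => kd.
  have pd := partner_lt kd.
  have pt := closed_lt pd.
  have dj := defect_of_labelP i hS hT (mem_nth 0 pt).
  have lj := hlab_defect_of_label i hS hT (mem_nth 0 pt).
  have [-> ->] := coarsen_closed kd di dj lE lj.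
  exact: CoarsenClosed.
have ks : index (hlab h i) t - delta < size s.
  by have := fib_le_size st; rewrite /delta in kd *; lia.
have lE' : hlab h i = nth 0 t (index (hlab h i) t - delta + delta) by rewrite subnK.
have [-> ->] := coarsen_kept ks di lE'.
exact: CoarsenKept.
Qed.

Lemma coarsen_defect i : defect (coarsen h) i ->
  exists k, [/\ k < size s, defect h i, hlab h i = nth 0 t (k + delta)
              & hlab (coarsen h) i = nth 0 s k].
Proof.
rewrite /defect; case: coarsenP => [ni /negPn|j k kd pd di dj li lj /eqP E|k ks di li _].
- by rewrite ni.
- by case: (nth_partner_neq kd); rewrite -li -lj E.
- by exists k.
Qed.

Lemma coarsen_hlab_le i : hlab (coarsen h) i <= hlab h i.
Proof.
case: (boolP (defect h i)) => di; last by have [_ ->] := coarsen_arc di.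
by rewrite ffunE di coarse_lab_le // (has_labels_mem hT).
Qed.


Lemma coarsen_labels : has_labels (coarsen h) s.
Proof.
move=> l; apply/idP/existsP => [ls|[i /andP[]]].
  have ks : index l s < size s by rewrite index_mem.
  have [i di li] := rank_exists (shift_lt ks); exists i.
  have [Em El] := coarsen_kept ks di li.
  by rewrite /defect Em El nth_index // !eqxx.
by case/coarsen_defect => k [ks _ _ ->] /eqP <-; apply: mem_nth.
Qed.

Lemma coarsen_parity : half_parity (coarsen h).
Proof.
move=> i; case: coarsenP => [ni|j k kd pd di dj li lj|k ks di li].
- exact: hP.
- rewrite leq_eqVlt (rank_lt di dj (closed_lt kd) (closed_lt pd) li lj).
  case/orP => [/eqP/val_inj E|lt].
    by case: (nth_partner_neq kd); rewrite -li -lj E.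
  have := sorted_nth_lt (fib_sorted tF) (closed_lt kd) (closed_lt pd).
  rewrite lt => /ltnW/minn_idPl->.
  by rewrite -li hP // (eqP di).
- move=> _; rewrite (fib_odd sF ks); have := hP (i := i).
  rewrite {1}(eqP di) leqnn li (fib_odd tF (shift_lt ks)) => /(_ isT) <-.
  by have := odd_delta; lia.
Qed.

(** The added arcs join defects of consecutive ranks, and no defect of a half is
    covered, so an added arc crosses neither an old arc nor another added one.
    They lie on the left of all remaining defects.  Labels change only at the old
    defects and do not increase there, so what was nested in a propagating arc
    keeps a larger label. *)
Lemma coarsen_shape : half_shape (coarsen h).
Proof.
have rk := rank_lt.
split.
- move=> i; case: (coarsenP i) => [ni|j k kd pd di dj li lj|k ks di li].
  + have nmi : ~~ defect h (hmate h i) by rewrite /defect (hmateK hS) eq_sym.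
    by have [-> _] := coarsen_arc nmi; apply: hmateK.
  + by have [->] := coarsen_closed pd dj di lj (etrans li (congr1 _ (esym (partnerK k)))).
  + by have [->] := coarsen_kept ks di li.
- move=> a c; case: (coarsenP a) => [na|a' k kd pd da da' la la'|k ks da la] ac;
  case: (coarsenP c) => [nc|c' l ld qd dc dc' lc lc'|l ls dc lc] => ca'.
  + exact: (hmate_noncross hS).
  + by case: (hmate_uncovered hS dc ac ca').
  + by lia.
  + by move=> lt; apply: (hmate_uncovered hS da' ca' lt).
  + move: ac ca'.
    rewrite (rk _ _ _ _ da dc (closed_lt kd) (closed_lt ld) la lc).
    rewrite (rk _ _ _ _ dc da' (closed_lt ld) (closed_lt pd) lc la').
    by rewrite /partner; case: ifP; lia.
  + by lia.
  + by lia.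
  + by lia.
  + by lia.
- move=> a c /coarsen_defect [l [ls dc lc _]].
  case: (coarsenP a) => [na|a' k kd pd da da' la la'|k ks da la] ac.
  + exact: (hmate_uncovered hS dc ac).
  + rewrite (rk _ _ _ _ dc da' (shift_lt ls) (closed_lt pd) lc la').
    by move: pd; lia.
  + by lia.
- move=> i; case: (coarsenP i) => [ni|j k kd pd di dj li lj|k ks di li].
  + have nmi : ~~ defect h (hmate h i) by rewrite /defect (hmateK hS) eq_sym.
    by have [_ ->] := coarsen_arc nmi; apply: hlab_hmate.
  + have [_ ->] := coarsen_closed pd dj di lj (etrans li (congr1 _ (esym (partnerK k)))).
    by rewrite partnerK minnC.
  + by have [] := coarsen_kept ks di li.
- move=> i; case: (coarsenP i) => [ni|j k kd pd di dj li lj|k ks di li].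
  + exact: hlab_gt0.
  + by rewrite -li -lj leq_min !hlab_gt0.
  + by apply: (fib_gt0 sF); apply: mem_nth.
- by move=> i; apply: leq_trans (coarsen_hlab_le i) _; apply: hlab_le.
- move=> a c; case: (coarsenP a) => [na|a' k kd pd da da' la la'|k ks da la];
  case: (coarsenP c) => [nc|c' l ld qd dc dc' lc lc'|l ls dc lc] ca aa' a'c'.
  + exact: (hlab_nested hS).
  + by rewrite -lc -lc' gtn_min (hlab_defect hS dc ca).
  + by lia.
  + case: (hmate_uncovered hS da ca); lia.
  + move: ca aa' a'c'.
    rewrite (rk _ _ _ _ dc da (closed_lt ld) (closed_lt kd) lc la).
    rewrite (rk _ _ _ _ da da' (closed_lt kd) (closed_lt pd) la la').
    rewrite (rk _ _ _ _ da' dc' (closed_lt pd) (closed_lt qd) la' lc').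
    by rewrite /partner; case: ifP; case: ifP; lia.
  + by lia.
  + by lia.
  + by lia.
  + by lia.
- move=> a c /coarsen_defect [l [ls dc lc ->]] ca.
  have lls : nth 0 s l <= hlab h c by rewrite lc dom_st.
  case: (coarsenP a) => [na|a' k kd pd da da' la la'|k ks da la].
  + exact: leq_ltn_trans lls (hlab_defect hS dc ca).
  + move: ca; rewrite (rk _ _ _ _ dc da (shift_lt ls) (closed_lt kd) lc la).
    by move: kd; lia.
  + rewrite (sorted_nth_lt (fib_sorted sF)) //.
    by move: ca; rewrite (rk _ _ _ _ dc da (shift_lt ls) (shift_lt ks) lc la); lia.
Qed.
Lemma coarsen_okada : okada_half s (coarsen h).
Proof. by split; [apply: coarsen_shape|apply: coarsen_parity|apply: coarsen_labels]. Qed.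

End CoarsenHalf.
End Coarsen.

(** * Products of joined half-diagrams *)

Section JoinMate.
Variables (N : nat) (h k : half_diagram N).

Lemma join_mate_arcl i : ~~ defect h i -> mate (join h k) (inl i) = inl (hmate h i).
Proof. by move=> ni; rewrite ffunE (negbTE ni). Qed.

Lemma join_mate_arcr j : ~~ defect k j -> mate (join h k) (inr j) = inr (hmate k j).
Proof. by move=> nj; rewrite ffunE (negbTE nj). Qed.

Lemma join_mate_propl i j : half_shape k -> defect h i -> defect k j ->
  hlab h i = hlab k j -> mate (join h k) (inl i) = inr j.
Proof. by move=> kS di dj E; rewrite ffunE di E (defect_of_labelE _ kS). Qed.

Lemma join_mate_propr i j : half_shape h -> defect h i -> defect k j ->
  hlab h i = hlab k j -> mate (join h k) (inr j) = inl i.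
Proof. by move=> hS di dj E; rewrite ffunE dj -E (defect_of_labelE _ hS). Qed.
End JoinMate.

Lemma coarsen_id N (h : half_diagram N) t : okada_half t h -> coarsen t t h = h.
Proof.
move=> hO; have hT := half_has_labels hO.
case: h {hO} hT => m l hT; rewrite /coarsen subnn; congr Half.
  by apply/ffunP=> i; rewrite ffunE /= andbF.
apply/ffunP=> i; rewrite ffunE /coarse_lab subnn /= subn0; case: ifP => // di.
by rewrite nth_index //; apply: (has_labels_mem hT).
Qed.

Section Product.
Variables (N : nat) (s t : seq nat) (a h b : half_diagram N).
Hypothesis st : fib_le s t.
Hypotheses (aO : okada_half s a) (hO : okada_half t h) (bO : okada_half t b).

Let hS : half_shape h := hO.
Let bS : half_shape b := bO.
Let hT := half_has_labels hO.
Let bT := half_has_labels bO.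
Let hc := coarsen s t h.
Let bc := coarsen s t b.
Let u := join a hc.
Let w := join h b.
Let hcO : okada_half s hc := coarsen_okada st hO.
Let bcO : okada_half s bc := coarsen_okada st bO.
Let uO : okada_spec u := join_okada aO hcO.
Let wO : okada_spec w := join_okada hO bO.

Let uw := glue u w.

Let step_l x y : mate u x = y -> connect uw (inl x) (inl y).
Proof. by move=> xy; apply: connect1; rewrite /uw glue_ll xy. Qed.
Let step_r x y : mate w x = y -> connect uw (inr x) (inr y).
Proof. by move=> xy; apply: connect1; rewrite /uw glue_rr xy. Qed.
Let cross_lr i : connect uw (inl (inr i)) (inr (inl i)).
Proof. by apply: connect1 => /=. Qed.
Let cross_rl i : connect uw (inr (inl i)) (inl (inr i)).
Proof. by apply: connect1 => /=. Qed.

Let usym : connect_sym uw.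
Proof. exact: connect_glue_sym (mateK uO) (mateK wO). Qed.

(** Such a path goes through [a], the coarsened [h], and [h] to [b]. *)
Lemma product_kept i j k : defect a i -> hlab a i = nth 0 s k -> k < size s ->
  defect b j -> hlab b j = nth 0 t (k + (size t - size s)) ->
  connect uw (inl (inl i)) (inr (inr j)).
Proof.
move=> di li ks dj lj.
have [j' dj' lj'] := rank_exists hO (shift_lt st ks).
have [mj' cj'] := coarsen_kept st ks dj' lj'.
apply: connect_trans (step_l (y := inr j') _) _.
  apply: (join_mate_propl hcO) => //; first by rewrite /defect /hc mj' eqxx.
  by rewrite cj'.
apply: connect_trans (cross_lr j') _; apply: step_r.
by apply: join_mate_propl => //; rewrite lj' lj.
Qed.

(** The path goes back through a propagating arc of the right factor, along an arc
    added to [h], and forth through the propagating arc paired with the first. *)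
Lemma product_closed j j2 k : k < size t - size s -> partner k < size t - size s ->
  defect b j -> defect b j2 -> hlab b j = nth 0 t k -> hlab b j2 = nth 0 t (partner k) ->
  connect uw (inr (inr j)) (inr (inr j2)).
Proof.
move=> kd pd dj dj2 lj lj2.
have [i di li] := rank_exists hO (closed_lt kd).
have [i2 di2 li2] := rank_exists hO (closed_lt pd).
have [mi _] := coarsen_closed st hO kd di di2 li li2.
have ni : ~~ defect hc i.
  apply/negP=> /(coarsen_defect st hO) [l [ls _ li' _]].
  have := rank_lt st hO di di (closed_lt kd) (shift_lt st ls) li li'.
  by rewrite ltnn; move: kd; lia.
apply: connect_trans (step_r (y := inl i) _) _.
  by apply: join_mate_propr => //; rewrite li lj.
apply: connect_trans (cross_rl i) _.
apply: connect_trans (step_l (y := inr i2) _) _.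
  by rewrite join_mate_arcr // mi.
apply: connect_trans (cross_lr i2) _; apply: step_r.
by apply: join_mate_propl => //; rewrite li2 lj2.
Qed.

Lemma product_connect x : connect uw (outer x) (outer (mate (join a bc) x)).
Proof.
have bcP' := coarsenP st bO.
have kept i j : defect a i -> defect bc j -> hlab a i = hlab bc j ->
    connect uw (inl (inl i)) (inr (inr j)).
  move=> di /(coarsen_defect st bO) [k [ks dj lj ->]] li.
  exact: product_kept lj.
case: (join_mateP aO bcO x) => [i -> ni|j ->|i j -> di dj E|i j -> di dj E] /=.
- by apply: step_l; apply: join_mate_arcl; apply/eqP.
- case: (bcP' j) => [nj _|j2 k kd pd dj dj2 lj lj2 _|//].
    by apply: step_r; apply: join_mate_arcr.
  exact: product_closed lj lj2.
- exact: kept.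
- by rewrite usym; apply: kept.
Qed.

(** The invariant for [dmul_lab_invariant].  The middle nodes carry the coarsened
    label in both factors, since that is the smaller one. *)
Let inv_lab (p : node N + node N) : nat :=
  match p with
  | inl (inl i) => hlab a i
  | inl (inr j) => hlab hc j
  | inr (inl j) => hlab hc j
  | inr (inr j) => hlab bc j
  end.

Let inv_lab_inl x : inv_lab (inl x) = lab u x.
Proof. by rewrite ffunE; case: x. Qed.

Let inv_lab_glue p q : glue u w p q -> inv_lab q = inv_lab p.
Proof.
have coarse i j : defect h i -> defect b j -> hlab h i = hlab b j -> hlab hc i = hlab bc j.
  by move=> di dj E; rewrite /hc /bc !ffunE di dj E.
case: p q => [x|x] [y|y].
- by rewrite glue_ll => /eqP->; rewrite !inv_lab_inl (lab_mate uO).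
- by case: x y => [x|x] [y|y] //= /eqP->.
- by case: x y => [x|x] [y|y] //= /eqP->.
rewrite glue_rr => /eqP ->.
case: (join_mateP hO bO x) => [i -> ni|j -> nj|i j -> di dj E|i j -> di dj E].
- by rewrite /= /hc /bc !ffunE /defect (hmateK hS) eq_sym (introF eqP ni) (hlab_hmate hS).
- by rewrite /= /hc /bc !ffunE /defect (hmateK bS) eq_sym (introF eqP nj) (hlab_hmate bS).
- by rewrite /= (coarse i j).
- by rewrite /= (coarse i j).
Qed.

Let inv_lab_le p : inv_lab p <= glue_lab u w p.
Proof.
case: p => x; first by rewrite inv_lab_inl.
by rewrite /= ffunE; case: x => i; apply: (coarsen_hlab_le st).
Qed.

Let inv_lab_attained x : exists2 p, connect uw (outer x) p & glue_lab u w p = inv_lab p.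
Proof.
case: x => [i|j] /=; first by exists (inl (inl i)); rewrite /= ?ffunE ?connect0.
case: (boolP (defect b j)) => dj; last first.
  by exists (inr (inr j)); rewrite ?connect0 //= !ffunE (negbTE dj).
have [i di E] := has_labels_defect hT (has_labels_mem bT dj).
exists (inl (inr i)); last by rewrite inv_lab_inl.
apply: connect_trans (step_r (y := inl i) _) (cross_rl i).
exact: join_mate_propr.
Qed.

Lemma join_product : dmul u w = join a bc.
Proof.
have gO : okada_spec (join a bc) by exact: join_okada aO bcO.
apply: diagram_eq => x.
  by apply: (dmul_mate (mateK uO) (mateK wO));
     [apply: mate_neq gO x|apply: product_connect].
have [p xp pl] := inv_lab_attained x.
by rewrite (dmul_lab_invariant inv_lab_glue inv_lab_le xp pl) ffunE; case: x {xp}.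
Qed.
End Product.

(** * Dominance implies comparability *)

Lemma fib_le_refl s : fibonacci s -> fib_le s s.
Proof. by move=> sF; split=> // k; rewrite subnn addn0. Qed.

Lemma fib_le_dominated N (e f : okada N) :
  dominated (PropLab e) (PropLab f) -> fib_le (labs (PropLab e)) (labs (PropLab f)).
Proof.
have half_of (d : okada N) := left_half_okada (is_okadaP d (okadaP d)).
case=> le dom; split; rewrite ?size_labs //.
- exact: half_fibonacci (half_of e) (labs_sorted _).
- exact: half_fibonacci (half_of f) (labs_sorted _).
- rewrite -!size_labs (odd_size_labels (half_of e)) ?labs_uniq //; last first.
    exact: half_has_labels (half_of e).
  by rewrite (odd_size_labels (half_of f)) ?labs_uniq //; exact: half_has_labels (half_of f).
- move=> k ke; have := dom (#|PropLab e| - k.+1) ltac:(lia).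
  rewrite !elemE; congr (nth _ _ _ <= nth _ _ _); lia.
Qed.

Lemma dominated_leJ N (e f : okada N) : dominated (PropLab e) (PropLab f) -> leJ e f.
Proof.
move=> /fib_le_dominated; set s := labs _; set t := labs _ => st.
have eO := is_okadaP e (okadaP e); have fO := is_okadaP f (okadaP f).
have eL : okada_half s (left_half e) := left_half_okada eO.
have fL : okada_half t (left_half f) := left_half_okada fO.
have eR : okada_half s (left_half (flip e)).
  by rewrite /s -PropLab_flip; apply/left_half_okada/flip_okada.
have fR : okada_half t (left_half (flip f)).
  by rewrite /t -PropLab_flip; apply/left_half_okada/flip_okada.
have fLc := coarsen_okada st fL; have fRc := coarsen_okada st fR.
have ss := fib_le_refl (fib_le_l st).
exists (Okada (introT (is_okadaP _) (join_okada eL fLc))).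
exists (Okada (introT (is_okadaP _) (join_okada fRc eR))) => /=.
have := join_product st eL fL fR; rewrite join_left_half // => ->.
have := join_product ss eL fRc eR.
by rewrite (coarsen_id fRc) (coarsen_id eR) join_left_half.
Qed.

(** * Comparability implies dominance *)

Lemma connect_exit (T : finType) (r : rel T) (A : pred T) x y :
  connect r x y -> A x -> ~~ A y ->
  exists p q, [/\ connect r x p, r p q, A p & ~~ A q].
Proof.
case/connectP => s; elim: s x => [x _ -> ->//|q s IH x /= /andP[xq qs] yE Ax nAy].
have [Aq|nAq] := boolP (A q); last by exists x, q; rewrite connect0.
have [p [p' [qp pp' Ap nAp']]] := IH q qs yE Aq nAy.
by exists p, p'; split=> //; apply: connect_trans (connect1 xq) qp.
Qed.

Section Crossing.
Variables (N : nat) (d e : diagram N).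

(** The unbarred nodes of [d] can only be left along a propagating arc of [d]. *)
Lemma cross_left i j : connect (glue d e) (outer (inl i)) (outer (inr j)) ->
  exists2 k, barred (mate d (inl k)) & connect (glue d e) (outer (inl i)) (inl (inl k)).
Proof.
move=> ij; pose A (p : node N + node N) := if p is inl (inl _) then true else false.
have [p [q [xp pq Ap nAq]]] := @connect_exit _ _ A _ _ ij isT isT.
case: p xp pq Ap => [[k|?]|?] // xk; case: q nAq => [q|[?|?]] // nAq.
by rewrite glue_ll => /eqP qE _; exists k => //; rewrite -qE; case: q nAq {qE}.
Qed.

(** The barred nodes of [e] can only be entered along a propagating arc of [e]. *)
Lemma cross_right i j : connect (glue d e) (outer (inl i)) (outer (inr j)) ->
  exists2 k, barred (mate e (inl k)) & connect (glue d e) (outer (inl i)) (inr (inl k)).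
Proof.
move=> ij; pose A (p : node N + node N) := if p is inr (inr _) then false else true.
have [p [q [xp pq Ap nAq]]] := @connect_exit _ _ A _ _ ij isT isT.
case: q pq nAq => [?|[?|q]] // pq _; case: p pq xp Ap => [[?|?]|[k|?]] //.
by rewrite glue_rr => /eqP qE xk _; exists k; rewrite -?qE.
Qed.
End Crossing.

Lemma dmul_lab_eq N (d e : diagram N) x y : connect_sym (glue d e) ->
  connect (glue d e) (outer x) (outer y) -> lab (dmul d e) x = lab (dmul d e) y.
Proof.
move=> sym xy; apply/eqP; rewrite eqn_leq; apply/andP; split; apply: dmul_lab_ge => p.
  by move/(connect_trans xy); apply: dmul_lab_le.
by rewrite sym in xy; move/(connect_trans xy); apply: dmul_lab_le.
Qed.

Lemma PropLab_inl N (d : okada N) l : l \in PropLab d ->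
  exists2 i, barred (mate d (inl i)) & lab d (inl i) = l.
Proof.
have dO := is_okadaP d (okadaP d) => lP.
have : val l \in labs (PropLab d) by apply: map_f; rewrite mem_enum.
case/(has_labels_defect (left_half_labels dO)) => i; rewrite left_half_defect // ffunE.
by exists i.
Qed.

(** The arc of [(uf)v] at the node [i] traverses the propagating arc of [f] at
    [k], by way of some propagating arc of [uf]. *)
Definition passes N (u f v : diagram N) (i k : 'I_N) : Prop :=
  exists2 j, connect (glue (dmul u f) v) (outer (inl i)) (inl (inl j)) /\
             barred (mate (dmul u f) (inl j))
   & connect (glue u f) (outer (inl j)) (inr (inl k)) /\ barred (mate f (inl k)).

(** If two arcs of [e] pass through the same arc of [f], then the propagating arcs
    of [uf] that they traverse have unbarred ends in one component, hence
    coincide by uniqueness of the mate; so the two arcs of [e] lie in one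
    component and have the same label. *)
Lemma leJ_inj N (e f : okada N) : leJ e f ->
  exists phi : 'I_N.+1 -> 'I_N.+1,
    {in PropLab e &, injective phi} /\
    {in PropLab e, forall l, phi l \in PropLab f /\ l <= phi l}.
Proof.
case=> u [v eE].
have uO := is_okadaP u (okadaP u); have fO := is_okadaP f (okadaP f).
have vO := is_okadaP v (okadaP v).
have uK := mateK uO; have fK := mateK fO; have vK := mateK vO.
have ufK := dmul_mateK uK fK.
have pass_ex (l : 'I_N.+1) : exists t : 'I_N.+1, l \in PropLab e ->
    t \in PropLab f /\ exists i k,
      [/\ passes u f v i k, lab e (inl i) = l & lab f (inl k) = t].
  case: (boolP (l \in PropLab e)) => [|nl]; last by exists l.
  case/PropLab_inl => i bi li.
  have := dmul_mate_connect (dmul u f) v (inl i); rewrite -eE.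
  case Ei : (mate e (inl i)) bi => [|i'] // _ /cross_left[j bj cj].
  have := dmul_mate_connect u f (inl j).
  case Ej : (mate (dmul u f) (inl j)) bj => [|j'] // _ /cross_right[k bk ck].
  have kN : lab f (inl k) < N.+1.
    by rewrite ltnS (leq_trans (lab_le fO _)) //=; apply: ltn_ord.
  exists (Ordinal kN); split.
    by rewrite inE; apply/existsP; exists (inl k); rewrite bk /=.
  exists i, k; split=> //; exists j; split=> //; by rewrite Ej.
have [phi phiP] := fin_all_exists pass_ex; exists phi; split.
  move=> l l' /phiP[_ [i [k [[j [cj bj] [ck bk]] lE kE]]]].
  move=> /phiP[_ [i' [k' [[j' [cj' bj'] [ck' bk']] lE' kE']]]] Ephi.
  have kk : k = k'.
    apply: (hlab_defect_inj (left_half_shape fO)); rewrite ?left_half_defect // !ffunE.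
    by rewrite kE kE' Ephi.
  have jj : j = j'.
    apply/eqP/negPn/negP => ne; have fs := connect_glue_sym uK fK.
    have c : connect (glue u f) (outer (inl j)) (outer (inl j')).
      by apply: connect_trans ck _; rewrite fs kk.
    have ne' : inl j' != inl j :> node N by apply/eqP => -[E]; rewrite E eqxx in ne.
    by have := dmul_mate uK fK ne' c; case: (mate _ _) bj.
  apply/val_inj/(etrans (esym lE))/(etrans _ lE').
  rewrite eE; apply: dmul_lab_eq; first exact: connect_glue_sym.
  by apply: connect_trans cj _; rewrite jj connect_glue_sym.
move=> l /phiP[tP [i [k [[j [cj bj] [ck bk]] lE kE]]]]; split=> //.
rewrite -lE -kE eE; apply: leq_trans (dmul_lab_le cj) _; exact: (dmul_lab_le ck).
Qed.

Lemma count_labs N (S : {set 'I_N.+1}) (p : pred nat) :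
  count p (labs S) = #|[set l in S | p (val l)]|.
Proof.
by rewrite count_map -sum1_count big_enum_cond -sum1_card; apply: eq_bigl => l; rewrite inE.
Qed.

(** If the element of [T] at depth [i] from the top were smaller than that of [S],
    the [i + 1] largest elements of [S] would inject into the [i] largest
    elements of [T]. *)
Lemma dominated_inj N (S T : {set 'I_N.+1}) (phi : 'I_N.+1 -> 'I_N.+1) :
  {in S &, injective phi} -> {in S, forall l, phi l \in T /\ l <= phi l} ->
  dominated S T.
Proof.
move=> phi_inj phiP.
have leST : #|S| <= #|T|.
  rewrite -(card_in_imset phi_inj); apply/subset_leq_card/subsetP => _ /imsetP[l lS ->].
  by case: (phiP l lS).
split=> // i iS; rewrite !elemE leqNgt; apply/negP.
set j := (#|S| - i).-1; set k := (#|T| - i).-1.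
have jS : j < size (labs S) by rewrite size_labs; lia.
have kT : k < size (labs T) by rewrite size_labs; lia.
have cj : #|[set l in S | val l < nth 0 (labs S) j]| = j.
  by rewrite -(count_labs _ (ltn^~ _)) (Order.POrderTheory.count_lt_nth 0 (labs_sorted S) jS).
have ck : #|[set l in T | val l <= nth 0 (labs T) k]| = k.+1.
  by rewrite -(count_labs _ (leq^~ _)) (Order.POrderTheory.count_le_nth 0 (labs_sorted T) kT).
move: (nth 0 _ k) (nth 0 _ j) cj ck => b a cj ck lt_ba.
have := cardsID [set l : 'I_N.+1 | l < a] S; have := cardsID [set l : 'I_N.+1 | l <= b] T.
suff : #|S :\: [set l : 'I_N.+1 | l < a]| <= #|T :\: [set l : 'I_N.+1 | l <= b]|.
  have -> : S :&: [set l : 'I_N.+1 | l < a] = [set l in S | (val l < a)].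
    by apply/setP=> l; rewrite !inE.
  have -> : T :&: [set l : 'I_N.+1 | l <= b] = [set l in T | (val l <= b)].
    by apply/setP=> l; rewrite !inE.
  rewrite ck cj /j /k; move: leST iS.
  move: #|S| #|T| #|S :\: _| #|T :\: _| => ? ? ? ?; lia.
rewrite -(card_in_imset (f := phi)); last first.
  by move=> l l'; rewrite !inE => /andP[_ lS] /andP[_ lS']; apply: phi_inj.
apply/subset_leq_card/subsetP => _ /imsetP[l + ->].
rewrite !inE => /andP[al lS]; have [-> lphi] := phiP l lS; lia.
Qed.

Lemma dominated_anti N (S T : {set 'I_N.+1}) : dominated S T -> dominated T S -> S = T.
Proof.
case=> leST domST [leTS domTS]; have E : #|S| = #|T| by apply/eqP; rewrite eqn_leq leST.
apply: labs_inj; apply: (@eq_from_nth _ 0); rewrite !size_labs // => k kS.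
apply/eqP; rewrite eqn_leq.
have := domST (#|S| - k.+1) ltac:(lia); have := domTS (#|S| - k.+1) ltac:(lia).
rewrite !elemE E; have -> : (#|T| - (#|T| - k.+1)).-1 = k by lia.
by move=> -> ->.
Qed.

Theorem theorem5p18 (N : nat) (e f : okada N) :
  (leJ e f <-> dominated (PropLab e) (PropLab f)) /\
  (eqJ e f <-> PropLab e = PropLab f).
Proof.
have leJE (x y : okada N) : leJ x y <-> dominated (PropLab x) (PropLab y).
  split=> [/leJ_inj[phi [inj le]]|]; [exact: dominated_inj inj le|exact: dominated_leJ].
split=> //; rewrite /eqJ; split=> [[/leJE ef /leJE fe]|E]; first exact: dominated_anti.
by split; apply/leJE; rewrite E.
Qed.
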